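(* Let $\mathbf{G}$ and $\mathbf{G}'$ be finite MW-graphs with $\mathbf{G}'=\mathbf{G}-e_0$ for some edge $e_0$ of $\mathbf{G}$. 1. If $\mathbf{G},\mathbf{G}'$ both have combinatorial weights, then $\mathbf{G}\stackrel{1}{\preccurlyeq}\mathbf{G}'$ and $\mathbf{G}'\sqsubseteq\mathbf{G}$, hence $\mathbf{G}\stackrel{1}{\preccurlyeq}\mathbf{G}'\preccurlyeq\mathbf{G}$. Furthermore, if $e_0$ is not a loop, then there exists $1\le k\le|\mathbf{G}|$ such that $\lambda_k(\mathbf{G}')<\lambda_k(\mathbf{G})$. 2. If $\mathbf{G},\mathbf{G}'$ both have standard weights, then $\mathbf{G}\stackrel{1}{\preccurlyeq}\mathbf{G}'\stackrel{1}{\preccurlyeq}\mathbf{G}$.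
   Context: Graphs: a graph $G=(V,E,\partial)$ consists of disjoint sets $V$ (vertices) and $E$ (edges), a map $\partial\colon E\to V\times V$, $\partial e=(\partial_-e,\partial_+e)$, and an involution $e\mapsto\bar e$ on $E$ with $e\neq\bar e$ and $\partial_\pm\bar e=\partial_\mp e$. Loops and multiple edges are allowed; $G$ need not be connected. $E_v=\{e\in E:\partial_-e=v\}$, $\deg(v)=|E_v|<\infty$ (a loop contributes $2$). MW-graphs: a weight $w$ consists of $w\colon V\to(0,\infty)$, $w\colon E\to(0,\infty)$. Combinatorial weights: $w(v)=1$, $w_e=1$. Standard weights: $w(v)=\deg(v)$, $w_e=1$. Fix a subgroup $R$ of $\mathbb{R}/2\pi\mathbb{Z}$; a magnetic potential is $\alpha\colon E\to R$ with $\alpha_{\bar e}=-\alpha_e$. An MW-graph is $\mathbf{G}=(G,\alpha,w)$; finite means $V$ finite, $|\mathbf{G}|=|V|$. $\mathbf{G}-e_0$ has underlying graph $(V,E\setminus\{e_0,\bar e_0\},\partial)$ and restricted magnetic potential; its weights are the combinatorial (resp. standard) weights of the new graph. $\mathbf{G}\sqsubseteq\mathbf{G}'$ means that there is an MW-homomorphism $\pi\colon\mathbf{G}\to\mathbf{G}'$, i.e. maps $\pi\colon V\to V'$, $\pi\colon E\to E'$ with $\pi(\partial_\pm e)=\partial'_\pm(\pi e)$, $\alpha_e=\alpha'_{\pi e}$ for all $e\in E$, $\sum_{\pi(v)=v'}w(v)\ge w'(v')$ for all $v'\in V'$, and $\sum_{\pi(e)=e'}w_e\le w'_{e'}$ for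 all $e'\in E'$. Spectral preorder: $\lambda_1(\mathbf{G})\le\dots\le\lambda_{|\mathbf{G}|}(\mathbf{G})$ are the eigenvalues, with multiplicity, of the magnetic Laplacian $(\Delta_\alpha\varphi)(v)=\frac1{w(v)}\sum_{e\in E_v}w_e\bigl(\varphi(v)-\mathrm{e}^{\mathrm{i}\alpha_e}\varphi(\partial_+e)\bigr)$, self-adjoint on $\ell_2(V,w)$. For standard weights each vertex of degree $0$ contributes by convention one eigenvalue $0$. For $r\in\mathbb{N}_0$, $\mathbf{G}\stackrel{r}{\preccurlyeq}\mathbf{G}'$ means $|\mathbf{G}|\ge|\mathbf{G}'|-r$ and $\lambda_k(\mathbf{G})\le\lambda_{k+r}(\mathbf{G}')$ for all $1\le k\le|\mathbf{G}'|-r$; $\preccurlyeq$ means $\stackrel{0}{\preccurlyeq}$; chains such as $\mathbf{A}\stackrel{r}{\preccurlyeq}\mathbf{B}\stackrel{s}{\preccurlyeq}\mathbf{C}$ mean that both relations hold. *)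

(* Defs.v *)
From HB Require Import structures.
From mathcomp Require Import all_boot all_order all_algebra.
From mathcomp Require Import generic_quotient ring_quotient archimedean complex.
From mathcomp Require Import all_classical all_reals all_analysis.
From mathcomp Require Import ring.

Set Implicit Arguments.
Unset Strict Implicit.
Unset Printing Implicit Defensive.

Import Order.TTheory GRing.Theory Num.Theory.
Local Open Scope quotient_scope.
Local Open Scope ring_scope.
Local Open Scope complex_scope.

Definition two_pi_int (R : realType) : {pred R} :=
  fun x : R => x / (pi *+ 2) \is a Num.int.

Lemma two_pi_int_zmod_closed (R : realType) : zmod_closed (@two_pi_int R).
Proof.
have E x : (x \in @two_pi_int R) = (x / (pi *+ 2) \is a Num.int) by [].
split=> [|x y]; rewrite !E ?mul0r ?rpred0 // => xI yI.
by rewrite mulrBl rpredB.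
Qed.

HB.instance Definition _ (R : realType) :=
  GRing.isZmodClosed.Build R (@two_pi_int R) (@two_pi_int_zmod_closed R).

(* The additive group R/2piZ. *)
Notation angle R := (Quotient.quot (@two_pi_int R)).

Definition expi (R : realType) (a : angle R) : R[i] :=
  cos (repr a) +i* sin (repr a).

Lemma expiE (R : realType) (x : R) :
  expi (\pi_(angle R) x) = cos x +i* sin x.
Proof.
rewrite /expi; set y := repr _.
have : x - y \in @two_pi_int R by rewrite Quotient.idealrBE reprK.
move=> /intrP[m]; have pi2 : pi *+ 2 != 0 :> R by rewrite mulrn_eq0 /= lt0r_neq0 ?pi_gt0.
move=> /(canRL (divfK pi2)) /(canRL (subrK _)) ->.
have perN (f : R -> R) k z : periodic f (pi *+ 2) -> f (k%:~R * (pi *+ 2) + z) = f z.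
  move=> fP; rewrite addrC; case: k => n.
    by rewrite -pmulrn mulr_natl periodicn.
  rewrite NegzE mulrNz mulNr -pmulrn mulr_natl.
  by rewrite -[in RHS](subrK ((pi *+ 2) *+ n.+1) z) (periodicn fP).
by rewrite !perN //; do ?[exact: sinD2pi | exact: cosD2pi].
Qed.

Lemma expiN (R : realType) (a : angle R) : expi (- a) = (expi a)^*%R.
Proof.
rewrite -[a]reprK.
have -> : - \pi_(angle R) (repr a) = \pi_(angle R) (- repr a).
  exact/esym/Quotient.pi_opp.
by rewrite !expiE cosN sinN.
Qed.

(* Finite graphs: each unoriented edge is the pair {e, bar e}. As all degrees
   are finite, the edge type of a graph with finitely many vertices is finite. *)
Record graph := Graph {
  vert : finType;
  edge : finType;
  bd : edge -> vert * vert;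
  bar : edge -> edge;
  barK : involutive bar;
  bar_neq : forall e, bar e != e;
  bd_bar : forall e, bd (bar e) = ((bd e).2, (bd e).1)
}.

Definition src (G : graph) (e : edge G) : vert G := (bd e).1.
Definition tgt (G : graph) (e : edge G) : vert G := (bd e).2.

Definition is_loop (G : graph) (e : edge G) : Prop := src e = tgt e.

(* A loop is counted twice, since e and bar e both start at v. *)
Definition deg (G : graph) (v : vert G) : nat :=
  #|[set e : edge G | src e == v]|.

Record mgraph (R : realType) (A : zmodClosed (angle R)) := MGraph {
  graph_of :> graph;
  alpha : edge graph_of -> angle R;
  alpha_in : forall e, alpha e \in A;
  alpha_bar : forall e, alpha (bar e) = - alpha e
}.

(* Vertex weights are positive, except that an isolated vertex may have weight
   0, as happens for the weight v |-> deg v. *)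
Record mwgraph (R : realType) (A : zmodClosed (angle R)) := MWGraph {
  mgraph_of :> mgraph A;
  vw : vert mgraph_of -> R;
  ew : edge mgraph_of -> R;
  vw_gt0 : forall v, 0 < vw v \/ (vw v = 0 /\ deg v = 0%N);
  ew_gt0 : forall e, 0 < ew e;
  ew_bar : forall e, ew (bar e) = ew e
}.

Section Deletion.
Variable (G : graph) (e0 : edge G).

Definition kept (e : edge G) : bool := (e != e0) && (e != bar e0).

Fact kept_bar (e : {e | kept e}) : kept (bar (val e)).
Proof.
case: e => e /= /andP[e1 e2]; apply/andP; split.
  by apply: contraNneq e2 => <-; rewrite barK.
by rewrite (inj_eq (can_inj (@barK G))).
Qed.

Definition del_bar (e : {e | kept e}) : {e | kept e} :=
  exist (fun e' => kept e') _ (kept_bar e).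

Fact del_barK : involutive del_bar.
Proof. by move=> e; apply: val_inj; rewrite /= barK. Qed.

Fact del_bar_neq e : del_bar e != e.
Proof. by rewrite -val_eqE /= bar_neq. Qed.

Definition del_graph : graph :=
  @Graph (vert G) {e | kept e} (fun e => bd (val e)) del_bar
    del_barK del_bar_neq (fun e => bd_bar (val e)).

End Deletion.

Definition del_mgraph (R : realType) (A : zmodClosed (angle R))
    (G : mgraph A) (e0 : edge G) : mgraph A :=
  @MGraph R A (del_graph e0) (fun e => alpha (val e))
    (fun e => alpha_in (val e)) (fun e => alpha_bar (val e)).

Section MWGraphs.
Variables (R : realType) (A : zmodClosed (angle R)).
Implicit Types G : mwgraph A.

Definition combinatorial G : Prop :=
  (forall v : vert G, vw v = 1) /\ (forall e : edge G, ew e = 1).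

Definition standard G : Prop :=
  (forall v : vert G, vw v = (deg v)%:R) /\ (forall e : edge G, ew e = 1).

Definition nvert G : nat := #|vert G|.

Definition is_mw_hom G G'
    (fv : vert G -> vert G') (fe : edge G -> edge G') : Prop :=
  [/\ forall e, src (fe e) = fv (src e) /\ tgt (fe e) = fv (tgt e),
      forall e, alpha e = alpha (fe e),
      forall v', vw v' <= \sum_(v | fv v == v') vw v
    & forall e', \sum_(e | fe e == e') ew e <= ew e'].

Definition mw_le G G' : Prop := exists fv fe, @is_mw_hom G G' fv fe.

(* At an isolated vertex the sum is empty, so the value is 0, also when its
   weight is 0: such a vertex contributes exactly one eigenvalue 0. *)
Definition laplacian G (phi : vert G -> R[i]) (v : vert G) : R[i] :=
  ((vw v)^-1)%:C *
  \sum_(e : edge G | src e == v)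
     (ew e)%:C * (phi v - expi (alpha e) * phi (tgt e)).

(* The matrix of the Laplacian in the basis of indicator functions; it acts on
   column vectors, see laplacian_mxE. *)
Definition laplacian_mx G : 'M[R[i]]_(nvert G) :=
  \matrix_(i, j) laplacian (fun v => (v == enum_val j)%:R) (enum_val i).

(* Eigenvalues counted with multiplicity, in nondecreasing order. Taking real
   parts loses nothing (see spectrumE), and algebraic and geometric
   multiplicities agree since the Laplacian is self-adjoint. *)
Definition spectrum G : seq R :=
  sort <=%R [seq complex.Re z |
             z <- sval (closed_field_poly_normal (char_poly (laplacian_mx G)))].

Lemma laplacian_mxE G phi i :
  laplacian phi (enum_val i) =
  \sum_j laplacian_mx G i j * phi (enum_val j).
Proof.
have enumK (v : vert G) :
  phi v = \sum_(j < #|vert G|) (v == enum_val j)%:R * phi (enum_val j).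
  rewrite (bigD1 (enum_rank v)) //= enum_rankK eqxx mul1r big1 ?addr0 // => j jv.
  case: eqP => [vj|_]; last by rewrite mul0r.
  by rewrite vj enum_valK eqxx in jv.
under eq_bigr do rewrite mxE -mulrA mulr_suml.
rewrite -mulr_sumr exchange_big /=; congr (_ * _); apply: eq_bigr => e _.
under eq_bigr do rewrite -mulrA.
rewrite -mulr_sumr; congr (_ * _).
rewrite {1}[phi _]enumK [phi (tgt e)]enumK mulr_sumr -sumrB.
by apply: eq_bigr => j _; rewrite mulrBl mulrA.
Qed.

Lemma laplacian_eigenvalue_real G (phi : vert G -> R[i]) (a : R[i]) v0 :
  phi v0 != 0 -> (forall v, laplacian phi v = a * phi v) -> a \is Num.real.
Proof.
move=> phi0 eig; pose N := \sum_v (vw v)%:C * `|phi v| ^+ 2.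
pose Q := \sum_e (ew e)%:C *
  (`|phi (src e)| ^+ 2 - (phi (src e))^*%R * expi (alpha e) * phi (tgt e)).
have vw_ge0 (v : vert G) : 0 <= vw v by case: (vw_gt0 v) => [/ltW //|[-> _]].
have NQ : a * N = Q.
  rewrite /Q (partition_big (@src G) predT) //= /N mulr_sumr.
  apply: eq_bigr => v _.
  have -> : a * ((vw v)%:C * `|phi v| ^+ 2) =
            (vw v)%:C * (phi v)^*%R * laplacian phi v.
    by rewrite eig normCK; ring.
  have -> : \sum_(e | src e == v) (ew e)%:C *
      (`|phi (src e)| ^+ 2 - (phi (src e))^*%R * expi (alpha e) * phi (tgt e)) =
      (phi v)^*%R * \sum_(e | src e == v)
         (ew e)%:C * (phi v - expi (alpha e) * phi (tgt e)).
    rewrite mulr_sumr; apply: eq_bigr => e /eqP ->.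
    by rewrite normCK; ring.
  rewrite /laplacian; case: (vw_gt0 v) => [v_gt0|[_ dv]].
    have vw0 : (vw v)%:C != 0 by rewrite (fmorph_eq0 (real_complex R)) gt_eqF.
    by rewrite fmorphV /= mulrACA divff ?mul1r.
  rewrite big_pred0 ?mulr0 // => e; apply/negP => ev.
  by move: dv; rewrite /deg (cardD1 e) inE ev.
have Qreal : Q \is Num.real.
  rewrite /Q; under eq_bigr do rewrite mulrBr.
  have ewR (e : edge G) : (ew e)%:C \is Num.real by rewrite complex_real.
  rewrite sumrB rpredB //.
    by apply: rpred_sum => e _; rewrite rpredM ?rpredX ?normr_real.
  rewrite CrealE rmorph_sum /= (reindex_inj (can_inj (@barK G))) /=.
  apply/eqP/eq_bigr => e _; rewrite !rmorphM /= conjCK (CrealP (ewR _)).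
  by rewrite ew_bar alpha_bar expiN conjCK /src /tgt bd_bar /=; ring.
have N_ge0 : 0 <= N.
  by apply: sumr_ge0 => v _; rewrite mulr_ge0 ?exprn_ge0 // lecR.
have [N0|N_neq0] := eqVneq N 0.
  have /eqP : (vw v0)%:C * `|phi v0| ^+ 2 = 0.
    apply: (psumr_eq0P (P := predT)) N0 _ isT => v _.
    by rewrite mulr_ge0 ?exprn_ge0 // lecR.
  rewrite mulf_eq0 expf_eq0 normr_eq0 (negPf phi0) orbF => /eqP[vw0].
  have /eqP := eig v0; rewrite /laplacian vw0 invr0 mul0r eq_sym mulf_eq0.
  by rewrite (negPf phi0) orbF => /eqP ->; rewrite rpred0.
rewrite -[a](mulfK N_neq0) NQ rpredM // rpredV.
exact: ger0_real.
Qed.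

Lemma spectrumE G :
  char_poly (laplacian_mx G) = \prod_(x <- spectrum G) ('X - (x%:C)%:P).
Proof.
have realP (z : R[i]) : root (char_poly (laplacian_mx G)) z -> z \is Num.real.
  have <- : char_poly (laplacian_mx G)^T = char_poly (laplacian_mx G).
    rewrite /char_poly -[RHS]det_tr; congr (\det _).
    by apply/matrixP => i j; rewrite !mxE eq_sym.
  rewrite -eigenvalue_root_char => /eigenvalueP[u uP].
  move=> /rV0Pn[j uj]; pose phi v := u 0 (enum_rank v).
  apply: (@laplacian_eigenvalue_real G phi z (enum_val j)).
    by rewrite /phi enum_valK.
  move=> v; rewrite -(enum_rankK v) laplacian_mxE.
  move/rowP: uP => /(_ (enum_rank v)); rewrite !mxE /phi enum_rankK => <-.
  by apply: eq_bigr => k _; rewrite enum_valK !mxE mulrC.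
rewrite /spectrum; case: closed_field_poly_normal => /= r.
rewrite (monicP (char_poly_monic _)) scale1r => cE.
rewrite (perm_big [seq complex.Re z | z <- r]) ?perm_sort //= big_map cE.
rewrite big_seq [RHS]big_seq; apply: eq_bigr => z zr.
have : z \is Num.real by apply: realP; rewrite cE root_prod_XsubC.
by case: z {zr} => x y; rewrite complex_real => /eqP ->.
Qed.

(* Indices start at 1. *)
Definition lambda G (k : nat) : R := nth 0 (spectrum G) k.-1.

(* The truncated subtraction is harmless: when #V(G') < r both conditions hold
   vacuously, as they do with integer subtraction. *)
Definition spectral_le (r : nat) G G' : Prop :=
  (nvert G' - r <= nvert G)%N /\
  forall k : nat, (1 <= k <= nvert G' - r)%N -> lambda G k <= lambda G' (k + r).

End MWGraphs.

(* Main.v *)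
Require Import Defs.
From mathcomp Require Import all_boot all_order all_algebra.
From mathcomp Require Import ring_quotient.
From mathcomp Require Import all_reals.
From mathcomp Require Import fingroup perm complex sesquilinear spectral trigo.
From mathcomp Require Import ring zify.

(** Write n for the number of vertices, [u] and [v] for the ends of the deleted
    edge, and z for its phase. For unit edge weights the Laplacian is the
    operator of the form
      q(phi) = sum over unoriented edges of |phi(src e) - z_e phi(tgt e)|^2
    relative to the squared norm N(phi) = sum_x w(x) |phi(x)|^2, so its eigenvalues are
    governed by the quotient q / N. Deleting the edge takes the single term
    |phi(u) - z phi(v)|^2 away from q. All comparisons are instances of one
    dimension count ([minmax_shift]): if, on a subspace cut out by r linear
    equations, every upper bound q' <= l N' implies q <= l N for the relevant
    eigenvalue l, then the k-th eigenvalue of (N, q) is at most the (k + r)-th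
    one of (N', q').

    - On the hyperplane phi(u) = z phi(v) the removed term vanishes, so q = q',
      while N' <= N; this gives the shift by one from G to G - e0 for both
      kinds of weights ([le_shift_del]).
    - For combinatorial weights N = N' and q' <= q, which gives the comparison
      without shift from G - e0 to G ([del_le]). If e0 is not a loop, the trace
      of the Laplacian drops by 2, so some eigenvalue drops strictly.
    - For standard weights deletion also shrinks N, by |phi(u)|^2 + |phi(v)|^2.
      On the hyperplane phi(u) = - z phi(v) this loss is 2 |phi(u)|^2, whereas q
      loses 4 |phi(u)|^2; as every eigenvalue of a standard Laplacian is at most
      2, the loss in q wins ([del_le_shift]).

    A vertex isolated by the deletion gets standard weight 0. Its row and column
    in the Laplacian vanish, so replacing this weight by a positive one changes
    no eigenvalue; the weight max(1, deg) makes N definite, still shrinks under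
    deletion, and does so by at most |phi(u)|^2 + |phi(v)|^2. *)

Set Implicit Arguments.
Unset Strict Implicit.
Unset Printing Implicit Defensive.

Import Order.TTheory GRing.Theory Num.Theory.
(* ring_scope comes last, so that ^* is the conjugation of numClosedFieldType *)
Local Open Scope complex_scope.
Local Open Scope ring_scope.
Local Open Scope sesquilinear_scope.

(** * Diagonalizing a matrix that is self-adjoint for a weighted inner product *)

Lemma char_poly_conj (F : fieldType) n (P D : 'M[F]_n) :
  P \in unitmx -> char_poly (invmx P *m D *m P) = char_poly D.
Proof.
move=> Pu; rewrite /char_poly /char_poly_mx.
have PK : map_mx polyC (invmx P) *m map_mx polyC P = 1%:M.
  by rewrite -map_mxM mulVmx // map_mx1.
have -> : 'X%:M - map_mx polyC (invmx P *m D *m P) =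
    map_mx polyC (invmx P) *m ('X%:M - map_mx polyC D) *m map_mx polyC P.
  by rewrite mulmxBr mulmxBl !map_mxM scalar_mxC -(mulmxA 'X%:M) PK mulmx1.
by rewrite !det_mulmx mulrAC -det_mulmx PK det1 mul1r.
Qed.

(** With D = diag(sqrt w), the matrix H = D M D^-1 is Hermitian and similar
    to M, so a unitary diagonalization of H, transported by D^-1, yields a
    basis orthonormal for w. Unique factorization of the characteristic
    polynomial then lets one permute this basis so that the eigenvalues come
    in the prescribed order [s]. *)
Lemma weighted_spectral (C : numClosedFieldType) n
    (w : 'rV[C]_n) (M : 'M[C]_n) (s : n.-tuple C) :
  (forall i, 0 < w 0 i) ->
  (forall i j, w 0 i * M i j = (w 0 j * M j i)^*) ->
  char_poly M = \prod_(x <- s) ('X - x%:P) ->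
  exists P : 'M[C]_n,
    P^t* *m diag_mx w *m P = 1%:M /\
    P^t* *m (diag_mx w *m M) *m P = diag_mx (\row_i tnth s i).
Proof.
move=> w_gt0 wM chM.
pose D := diag_mx (\row_i sqrtC (w 0 i)).
pose D' := diag_mx (\row_i (sqrtC (w 0 i))^-1).
have rw_gt0 i : 0 < sqrtC (w 0 i) by rewrite sqrtC_gt0.
have DD' : D *m D' = 1%:M.
  rewrite mulmx_diag -diag_const_mx; congr diag_mx.
  by apply/rowP => i; rewrite !mxE divff // gt_eqF.
have D'D : D' *m D = 1%:M by apply: mulmx1C.
have DD : D *m D = diag_mx w.
  by rewrite mulmx_diag; congr diag_mx; apply/rowP => i; rewrite !mxE -expr2 sqrtCK.
have D't : D' ^t* = D'.
  rewrite tr_diag_mx map_diag_mx; congr diag_mx; apply/rowP => i; rewrite !mxE.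
  by apply/CrealP; rewrite realV; apply/gtr0_real.
have wMH : (diag_mx w *m M) ^t* = diag_mx w *m M.
  apply/matrixP => i j; rewrite mxE mxE !mul_diag_mx ![(\matrix_(_, _) _) _ _]mxE.
  by rewrite -wM.
pose H := D *m M *m D'.
have HE : H = D' *m (diag_mx w *m M) *m D'.
  by rewrite -DD !mulmxA D'D mul1mx.
have Hherm : H \is hermsymmx.
  apply/is_hermitianmxP; rewrite expr0 scale1r HE.
  by rewrite !trmx_mul !map_mxM D't -[X in D' *m X *m D']wMH trmx_mul map_mxM mulmxA.
have Hn := orthomx_spectralP (hermitian_normalmx Hherm).
set U := spectralmx H in Hn; set e := spectral_diag H in Hn.
have Uun : U \is unitarymx by apply: spectral_unitarymx.
have Uu : U \in unitmx by apply: spectral_unit.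
have Du : D \in unitmx by case/mulmx1_unit: DD'.
have ME : M = invmx (U *m D) *m diag_mx e *m (U *m D).
  have -> : invmx (U *m D) = D' *m invmx U.
    have UDu : U *m D \in unitmx by rewrite unitmx_mul Uu Du.
    by rewrite -[RHS](mulKmx UDu) -(mulmxA U) (mulmxA D) DD' mul1mx mulmxV // mulmx1.
  rewrite -!mulmxA (mulmxA (diag_mx e)) (mulmxA (invmx U)) (mulmxA (invmx U)) -Hn.
  by rewrite /H -!mulmxA D'D mulmx1 mulmxA D'D mul1mx.
have : perm_eq [seq e 0 i | i <- enum 'I_n] s.
  apply: prod_XsubC_eq; rewrite -chM ME char_poly_conj ?unitmx_mul ?Uu ?Du //.
  rewrite char_poly_trig ?diag_mx_is_trig // big_map big_enum /=.
  by apply: eq_bigr => i _; rewrite mxE eqxx mulr1n.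
have -> : [seq e 0 i | i <- enum 'I_n] = [tuple e 0 i | i < n] by [].
rewrite perm_sym => /tuple_permP[p sE].
have sP i : tnth s i = e 0 (p i).
  have -> : s = [tuple tnth [tuple e 0 j | j < n] (p i) | i < n] by apply: val_inj.
  by rewrite !tnth_mktuple.
have pK : perm_mx p *m (perm_mx p)^T = 1%:M :> 'M[C]_n.
  by rewrite tr_perm_mx -perm_mxM mulgV perm_mx1.
exists (D' *m U^t* *m (perm_mx p)^T).
have Pt : (D' *m U^t* *m (perm_mx p)^T)^t* = perm_mx p *m U *m D'.
  by rewrite !trmx_mul !map_mxM D't trmxCK trmxK map_perm_mx mulmxA.
have UU : U *m U^t* = 1%:M by apply/unitarymxP.
rewrite Pt; split.
  rewrite -DD !mulmxA -(mulmxA _ D' D) D'D mulmx1 -(mulmxA _ D D') DD' mulmx1.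
  by rewrite -(mulmxA _ U) UU mulmx1.
rewrite !mulmxA.
have -> : perm_mx p *m U *m D' *m diag_mx w *m M *m D' *m U^t* *m (perm_mx p)^T =
  perm_mx p *m (U *m H *m U^t*) *m (perm_mx p)^T by rewrite HE !mulmxA.
rewrite Hn !mulmxA mulmxK //.
rewrite -(mulmxA _ U) UU mulmx1.
rewrite tr_perm_mx -row_permE -col_permE; apply/matrixP => i j.
by rewrite !mxE sP (inj_eq perm_inj).
Qed.

(** * Comparing spectra by dimension count *)

Lemma exists_ker_vector (F : fieldType) m n (A : 'M[F]_(m, n)) :
  (m < n)%N -> exists2 u : 'cV[F]_n, u != 0 & A *m u = 0.
Proof.
move=> mn; have : kermx A^T != 0.
  by rewrite -mxrank_eq0 mxrank_ker subn_eq0 -ltnNge (leq_ltn_trans (rank_leq_col _)).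
move=> /rowV0Pn[v /sub_kermxP vA v0]; exists v^T.
  by rewrite -trmx_eq0 trmxK.
by rewrite -[A]trmxK -trmx_mul vA trmx0.
Qed.

Section Diagonalized.
Variables (R : realType) (V : finType).
Local Notation C := R[i].
Implicit Types (N q : (V -> C) -> C) (s : nat -> R) (phi : V -> C).

Definition fun_of_col (u : 'cV[C]_#|V|) (v : V) : C := u (enum_rank v) 0.

(** [N] is a squared norm and [q] a quadratic form, given only through
    orthonormal coordinates: in the basis formed by the columns of [P], [N] is
    the standard norm and [q] is diagonal with nondecreasing eigenvalues [s].
    This is all that the comparison of spectra uses. *)
Definition diagonalized N q s : Prop :=
  (forall i j, (i <= j < #|V|)%N -> s i <= s j) /\
  exists2 P : 'M[C]_#|V|, P \in unitmx & forall c : 'cV[C]_#|V|,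
    N (fun_of_col (P *m c)) = \sum_i `|c i 0| ^+ 2 /\
    q (fun_of_col (P *m c)) = \sum_(i < #|V|) (s i)%:C * `|c i 0| ^+ 2.

(** Put l = k + r. Requiring that the coordinates of [phi] below k vanish in
    the first basis, that those above l vanish in the second, and that the r
    constraints [h] hold, amounts to k + (n - l - 1) + r = n - 1 linear
    equations, so a nonzero [phi] satisfies them all. For this [phi],
    s_k N <= q by the first requirement and q' <= s'_l N' by the second, and
    the transfer hypothesis closes the chain s_k N <= q <= s'_l N. *)
Lemma minmax_shift N q s N' q' s' r (h : 'I_r -> V -> C) k :
  diagonalized N q s -> diagonalized N' q' s' -> (k + r < #|V|)%N ->
  (forall phi, (forall i, \sum_v h i v * phi v = 0) ->
     q' phi <= (s' (k + r)%N)%:C * N' phi -> q phi <= (s' (k + r)%N)%:C * N phi) ->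
  s k <= s' (k + r)%N.
Proof.
move=> [s_mono [P Pu PE]] [s'_mono [P' P'u P'E]] krV transfer.
set l := (k + r)%N in krV transfer *.
have kV : (k < #|V|)%N by apply: leq_ltn_trans krV; rewrite leq_addr.
pose lo (i : 'I_k) : 'I_#|V| := widen_ord (ltnW kV) i.
(* the default value of insubd is never reached, as l + 1 + i < n *)
pose hi (i : 'I_(#|V| - l.+1)) : 'I_#|V| := insubd (Ordinal kV) (l.+1 + i)%N.
pose hm : 'M[C]_(r, #|V|) := \matrix_(i, j) h i (enum_val j).
pose M := col_mx (col_mx (rowsub lo (invmx P)) (rowsub hi (invmx P'))) hm.
have [|u u0 Mu] := @exists_ker_vector _ _ _ M.
  by move: krV; rewrite /l; lia.
have /eq_col_mx[/eq_col_mx[loE hiE] hE] :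
  col_mx (col_mx (rowsub lo (invmx P) *m u) (rowsub hi (invmx P') *m u)) (hm *m u)
    = col_mx (col_mx 0 0) 0 by rewrite -!mul_col_mx Mu !col_mx0.
pose c := invmx P *m u; pose c' := invmx P' *m u.
have uE : u = P *m c by rewrite mulKVmx.
have uE' : u = P' *m c' by rewrite mulKVmx.
have [Nc qc] := PE c; have [Nc' qc'] := P'E c'.
rewrite -uE in Nc qc; rewrite -uE' in Nc' qc'.
have c_lo (i : 'I_#|V|) : (i < k)%N -> c i 0 = 0.
  move=> ik; move/matrixP: loE => /(_ (Ordinal ik) 0).
  rewrite [RHS]mxE => <-; rewrite !mxE; apply: eq_bigr => j _.
  by rewrite mxE; congr (invmx P _ _ * _); apply: val_inj.
have c_hi (i : 'I_#|V|) : (l < i)%N -> c' i 0 = 0.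
  move=> li; have iP : (i - l.+1 < #|V| - l.+1)%N.
    by rewrite ltn_sub2r // (leq_ltn_trans li).
  move/matrixP: hiE => /(_ (Ordinal iP) 0).
  rewrite [RHS]mxE => <-; rewrite !mxE; apply: eq_bigr => j _.
  rewrite mxE; congr (invmx P' _ _ * _); apply: val_inj.
  by rewrite val_insubd /= subnKC // ltn_ord.
have {transfer} le_q : \sum_(i < #|V|) (s i)%:C * `|c i 0| ^+ 2 <=
    (s' l)%:C * \sum_i `|c i 0| ^+ 2.
  rewrite -Nc -qc; apply: transfer => [i|]; last first.
    rewrite Nc' qc' mulr_sumr; apply: ler_sum => i _.
    have [il|li] := leqP i l; last by rewrite c_hi // normr0 expr0n !mulr0.
    by rewrite ler_wpM2r ?exprn_ge0 // lecR s'_mono // il.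
  move/matrixP: hE => /(_ i 0); rewrite !mxE => hE.
  rewrite -[RHS]hE (reindex_onto enum_val enum_rank) /=; last by move=> v _; rewrite enum_rankK.
  apply: eq_big => [j|j _]; first by rewrite enum_valK eqxx.
  by rewrite /fun_of_col enum_valK mxE.
(* N(phi) > 0 allows cancelling it in s_k N <= s'_l N *)
have N_gt0 : 0 < \sum_i `|c i 0| ^+ 2.
  rewrite lt_def sumr_ge0 => [|i _]; last exact: exprn_ge0.
  rewrite andbT; apply: contraNneq u0 => /psumr_eq0P c0.
  rewrite uE; suff -> : c = 0 by rewrite mulmx0.
  apply/colP => i; rewrite [RHS]mxE; apply/eqP; rewrite -normr_eq0 -sqrf_eq0.
  by rewrite c0 // => j _; rewrite exprn_ge0.
rewrite -lecR -(ler_pM2r N_gt0) (le_trans _ le_q) // mulr_sumr.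
apply: ler_sum => i _; have [ki|ik] := leqP k i; last first.
  by rewrite c_lo // normr0 expr0n !mulr0.
by rewrite ler_wpM2r ?exprn_ge0 // lecR s_mono // ki ltn_ord.
Qed.

Lemma diagonalized_eigen N q s i :
  diagonalized N q s -> (i < #|V|)%N ->
  exists2 phi, N phi = 1 & q phi = (s i)%:C.
Proof.
move=> [_ [P _ PE]] iV; pose j := Ordinal iV.
have [N1 q1] := PE (\col_l (l == j)%:R).
exists (fun_of_col (P *m (\col_l (l == j)%:R))).
  rewrite N1 (bigD1 j) //= mxE eqxx normr1 expr1n big1 ?addr0 // => l lj.
  by rewrite mxE (negPf lj) normr0 expr0n.
rewrite q1 (bigD1 j) //= mxE eqxx normr1 expr1n mulr1 big1 ?addr0 // => l lj.
by rewrite mxE (negPf lj) normr0 expr0n mulr0.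
Qed.

End Diagonalized.

(** * The quadratic form of the Laplacian *)

Lemma normr_expi (R : realType) (a : angle R) : `|expi a| = 1.
Proof. by rewrite /expi normc_def /= cos2Dsin2 sqrtr1. Qed.

Definition wsqnorm (R : realType) (V : finType) (w : V -> R) (phi : V -> R[i]) :=
  \sum_v (w v)%:C * `|phi v| ^+ 2.

Lemma le_wsqnorm (R : realType) (V : finType) (w w' : V -> R) (phi : V -> R[i]) :
  (forall v, w v <= w' v) -> wsqnorm w phi <= wsqnorm w' phi.
Proof.
by move=> ww'; apply: ler_sum => v _; rewrite ler_wpM2r ?exprn_ge0 // lecR.
Qed.

Section Energy.
Variables (R : realType) (A : zmodClosed (angle R)).
Local Notation C := R[i].

(** The sum runs over oriented edges, and both orientations of an edge
    contribute equally, hence the factor 1/2. *)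
Definition energy (G : mgraph A) (phi : vert G -> C) : C :=
  2^-1 * \sum_e `|phi (src e) - expi (alpha e) * phi (tgt e)| ^+ 2.

Lemma energy_ge0 (G : mgraph A) (phi : vert G -> C) : 0 <= energy phi.
Proof.
by rewrite mulr_ge0 ?invr_ge0 ?ler0n // sumr_ge0 // => e _; rewrite exprn_ge0.
Qed.

(** Pairing each edge with its reverse turns the sum of the products
    conj(phi) * (Laplacian term) into the sum of the squares. *)
Lemma energyE (G : mgraph A) (phi : vert G -> C) :
  energy phi =
  \sum_e (phi (src e))^* * (phi (src e) - expi (alpha e) * phi (tgt e)).
Proof.
set S := RHS; suff -> : energy phi = 2^-1 * (S + S).
  by rewrite -mulr2n -[S *+ 2]mulr_natl mulKf // pnatr_eq0.
have barS : S = \sum_e (phi (tgt e))^* *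
    (phi (tgt e) - (expi (alpha e))^* * phi (src e)).
  rewrite /S (reindex_inj (can_inj (@barK G))) /=; apply: eq_bigr => e _.
  by rewrite /src /tgt bd_bar alpha_bar expiN.
rewrite {2}barS -big_split; congr (_ * _); apply: eq_bigr => e _ /=.
set x := phi _; set y := phi _; set z := expi _.
have zz : z^* * z = 1 by rewrite mulrC -normCK normr_expi expr1n.
rewrite normCK rmorphB rmorphM /=; transitivity
  (x^* * (x - z * y) + (z^* * z * y * y^* - y^* * z^* * x)); first by ring.
by rewrite zz; ring.
Qed.

Lemma sum_deg (V : nmodType) (G : graph) (F : vert G -> V) :
  \sum_v F v *+ deg v = \sum_e F (src e).
Proof.
rewrite (partition_big (@src G) predT) //=; apply: eq_bigr => v _.
transitivity (\sum_(e : edge G | src e == v) F v).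
  by rewrite sumr_const /deg cardsE.
by apply: eq_bigr => e /eqP ->.
Qed.

(** From |a - z b|^2 <= 2 (|a|^2 + |b|^2) for every edge; this is why a
    standard Laplacian has no eigenvalue above 2. *)
Lemma energy_le_wsqnorm (G : mgraph A) (phi : vert G -> C) :
  energy phi <= 2 * wsqnorm (fun v => (deg v)%:R) phi.
Proof.
have -> : wsqnorm (fun v : vert G => (deg v)%:R) phi = \sum_e `|phi (src e)| ^+ 2.
  rewrite -(sum_deg (fun v => `|phi v| ^+ 2)); apply: eq_bigr => v _.
  by rewrite rmorph_nat mulr_natl.
set S := \sum_e _.
have ST : S = \sum_e `|phi (tgt e)| ^+ 2.
  rewrite /S (reindex_inj (can_inj (@barK G))) /=.
  by apply: eq_bigr => e _; rewrite /src bd_bar.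
rewrite /energy mulrC ler_pdivrMr ?ltr0n //.
have -> : 2 * S * 2 = \sum_e 2 * (`|phi (src e)| ^+ 2 + `|phi (tgt e)| ^+ 2).
  by rewrite -mulr_sumr big_split /= -ST -/S; ring.
apply: ler_sum => e _; set x := phi _; set y := phi _.
have le1 : `|x - expi (alpha e) * y| <= `|x| + `|y|.
  by rewrite (le_trans (ler_normB _ _)) // normrM normr_expi mul1r.
rewrite (le_trans (lerXn2r 2 _ _ le1)) ?nnegrE ?addr_ge0 //.
rewrite -subr_ge0; have -> : 2 * (`|x| ^+ 2 + `|y| ^+ 2) - (`|x| + `|y|) ^+ 2 =
  (`|x| - `|y|) ^+ 2 by ring.
by rewrite real_exprn_even_ge0 // rpredB ?normr_real.
Qed.

End Energy.

Section LaplacianForms.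
Variables (R : realType) (A : zmodClosed (angle R)).
Local Notation C := R[i].

Lemma size_spectrum (G : mwgraph A) : size (spectrum G) = #|vert G|.
Proof.
have /(congr1 (fun p : {poly C} => size p)) := spectrumE G.
by rewrite size_char_poly size_prod_XsubC => -[].
Qed.

Lemma spectrum_sorted (G : mwgraph A) : sorted <=%R (spectrum G).
Proof. exact/sort_sorted/le_total. Qed.

(** Multiplying the Laplacian by the diagonal matrix of weights gives the
    Hermitian matrix of the energy, so [weighted_spectral] applies. The weight
    of an isolated vertex does not enter the Laplacian, so it may
    be replaced by any positive number. This is how the weight 0 of an isolated
    vertex in the standard case is reconciled with a positive definite norm. *)
Lemma laplacian_diagonalized (G : mwgraph A) (w : vert G -> R) :
  (forall e : edge G, ew e = 1) -> (forall v, 0 < w v) ->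
  (forall v : vert G, deg v = 0%N \/ vw v = w v) ->
  diagonalized (wsqnorm w) (@energy R A G) (nth 0 (spectrum G)).
Proof.
move=> ew1 w_gt0 wE; set s := spectrum G.
have sz : size s = #|vert G| by apply: size_spectrum.
split=> [i j /andP[ij jV]|].
  apply: (sorted_leq_nth le_trans lexx 0 (spectrum_sorted G)); rewrite ?inE ?size_spectrum //.
  exact: leq_ltn_trans jV.
have wL v (phi : vert G -> C) : (w v)%:C * laplacian phi v =
    \sum_(e | src e == v) (phi v - expi (alpha e) * phi (tgt e)).
  rewrite /laplacian; under eq_bigr do rewrite ew1 mul1r.
  have [v0|->] := wE v.
    rewrite big_pred0 ?mulr0 // => e; apply/negP => ev.
    by move: v0; rewrite /deg (cardD1 e) inE ev.
  by rewrite mulrA fmorphV mulfV ?mul1r // (fmorph_eq0 (real_complex R)) gt_eqF.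
pose wr : 'rV[C]_#|vert G| := \row_i (w (enum_val i))%:C.
have st : size [seq x%:C | x <- s] == #|vert G| by rewrite size_map sz.
have [|i j||P [PN Pq]] := @weighted_spectral _ _ wr (laplacian_mx G) (Tuple st).
- by move=> i; rewrite mxE ltcR.
  (* hermitian symmetry: reversing the edges exchanges the two entries *)
- rewrite /wr /laplacian_mx !mxE !wL !sumrB rmorphB /=; congr (_ - _).
    have [->|ij] := eqVneq (enum_val i) (enum_val j).
      by rewrite rmorph_sum; apply: eq_bigr => e _; rewrite rmorph_nat.
    by rewrite !big1 ?rmorph0.
  rewrite big_mkcond [X in (X)^*]big_mkcond (reindex_inj (can_inj (@barK G))) /=.
  rewrite rmorph_sum; apply: eq_bigr => e _.
  rewrite /src /tgt bd_bar alpha_bar expiN /=.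
  by do 2 case: eqP => _ /=; rewrite ?mulr1 ?mulr0 ?rmorph0.
- by rewrite /= big_map spectrumE.
have wsqnormE u : wsqnorm w (fun_of_col u) = (u^t* *m diag_mx wr *m u) 0 0.
  rewrite /wsqnorm mxE (reindex_onto enum_val enum_rank) /=; last first.
    by move=> v _; rewrite enum_rankK.
  apply: eq_big => [i|i _]; first by rewrite enum_valK eqxx.
  by rewrite /fun_of_col enum_valK mul_mx_diag !mxE normCK; ring.
have energy_mxE u : energy (fun_of_col u) =
    (u^t* *m (diag_mx wr *m laplacian_mx G) *m u) 0 0.
  rewrite energyE (partition_big (@src G) predT) //= -mulmxA mxE.
  rewrite (reindex_onto enum_val enum_rank) /=; last first.
    by move=> v _; rewrite enum_rankK.
  apply: eq_big => [i|i _]; first by rewrite enum_valK eqxx.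
  transitivity ((fun_of_col u (enum_val i))^* *
      ((w (enum_val i))%:C * laplacian (fun_of_col u) (enum_val i))).
    by rewrite wL mulr_sumr; apply: eq_bigr => e /eqP ->.
  rewrite laplacian_mxE -mulmxA mul_diag_mx !mxE /fun_of_col enum_valK.
  by congr (_ * (_ * _)); apply: eq_bigr => k _; rewrite enum_valK.
exists P => [|c]; first by case/mulmx1_unit: PN.
have cE (D : 'M[C]_#|vert G|) :
    (P *m c)^t* *m D *m (P *m c) = c^t* *m (P^t* *m D *m P) *m c.
  by rewrite trmx_mul map_mxM !mulmxA.
rewrite wsqnormE energy_mxE !cE PN Pq mulmx1 mul_mx_diag !mxE.
split; apply: eq_bigr => i _; rewrite !mxE normCK 1?mulrC //.
by rewrite (tnth_nth 0) (nth_map 0) ?sz //=; ring.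
Qed.

(** Both sides are minus the subleading coefficient of the characteristic
    polynomial. *)
Lemma sum_spectrum (G : mwgraph A) :
  (\sum_(i < #|vert G|) (spectrum G)`_i)%:C = \tr (laplacian_mx G).
Proof.
have sz := size_spectrum G; have [n0|n_gt0] := posnP #|vert G|.
  by rewrite /mxtrace !big1 // => i; have := ltn_ord i; rewrite /nvert [X in (_ < X)%N]n0.
have := char_poly_trace (laplacian_mx G) n_gt0; rewrite spectrumE.
rewrite -(big_map (real_complex R) xpredT (fun x => 'X - x%:P)).
have := @coefPn_prod_XsubC _ [seq x%:C | x <- spectrum G].
rewrite size_map sz -lt0n => /(_ n_gt0) -> /oppr_inj <-.
by rewrite big_map rmorph_sum (big_nth 0) sz big_mkord.
Qed.

Lemma tr_laplacian (G : mwgraph A) : combinatorial G ->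
  \tr (laplacian_mx G) =
  \sum_(e : edge G) (1 - expi (alpha e) * (tgt e == src e)%:R).
Proof.
move=> [vw1 ew1]; rewrite [RHS](partition_big (@src G) predT) //= /mxtrace.
rewrite [RHS](reindex_onto enum_val enum_rank) /=; last first.
  by move=> v _; rewrite enum_rankK.
apply: eq_big => [i|i _]; first by rewrite enum_valK eqxx.
rewrite mxE /laplacian vw1 invr1 mul1r eqxx; apply: eq_bigr => e /eqP ->.
by rewrite ew1 mul1r.
Qed.

Lemma diagonalized_ge0 (G : mgraph A) N s i :
  diagonalized N (@energy R A G) s -> (i < #|vert G|)%N -> 0 <= s i.
Proof.
move=> d iV; have [phi _ e] := diagonalized_eigen d iV.
by rewrite -lecR -e energy_ge0.
Qed.

Lemma diagonalized_le2 (G : mgraph A) (w : vert G -> R) s i :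
  (forall v : vert G, (deg v)%:R <= w v) ->
  diagonalized (wsqnorm w) (@energy R A G) s -> (i < #|vert G|)%N -> s i <= 2.
Proof.
move=> deg_w d iV; have [phi N1 e] := diagonalized_eigen d iV.
rewrite -lecR -e (le_trans (energy_le_wsqnorm _)) // rmorph_nat -[X in _ <= X]mulr1.
by rewrite ler_wpM2l ?ler0n // -N1 le_wsqnorm.
Qed.

End LaplacianForms.

(** * Deleting an edge *)

Lemma sum_delta (S : nzRingType) (V : finType) (x : V) (f : V -> S) :
  \sum_v (x == v)%:R * f v = f x.
Proof.
rewrite (bigD1 x) //= eqxx mul1r big1 ?addr0 // => v.
by rewrite eq_sym => /negPf ->; rewrite mul0r.
Qed.

(** The left side is the shape in which [minmax_shift] takes linear
    constraints; with [z] a phase it is the condition that the edge from [x]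
    to [y] puts on [phi]. *)
Lemma sum_hyperplane (S : comNzRingType) (V : finType) (x y : V) (z : S) (phi : V -> S) :
  \sum_v ((x == v)%:R - z * (y == v)%:R) * phi v = phi x - z * phi y.
Proof.
under eq_bigr do rewrite mulrBl -mulrA.
by rewrite sumrB -mulr_sumr !sum_delta.
Qed.


Lemma sum_del (V : nmodType) (G : graph) (e0 : edge G) (F : edge G -> V) :
  \sum_e F e = F e0 + F (bar e0) + \sum_(e : edge (del_graph e0)) F (val e).
Proof.
rewrite (bigD1 e0) //= (bigD1 (bar e0)) ?bar_neq //= addrA; congr (_ + _).
rewrite (reindex_omap (fun e : edge (del_graph e0) => val e) insub) /=.
  apply: eq_bigl => e; rewrite valK eqxx andbT; exact: (valP e).
by move=> e ke; rewrite insubT.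
Qed.

Lemma deg_sum (G : graph) (v : vert G) : deg v = (\sum_e (src e == v))%N.
Proof. by rewrite /deg -sum1dep_card big_mkcond; apply: eq_bigr => e _; case: eqP. Qed.

Lemma deg_del (G : graph) (e0 : edge G) (v : vert G) :
  deg v = ((src e0 == v) + (tgt e0 == v) + @deg (del_graph e0) v)%N.
Proof.
by rewrite deg_sum (sum_del e0) (@deg_sum (del_graph e0)) /src /tgt bd_bar.
Qed.

Section Deletion.
Variables (R : realType) (A : zmodClosed (angle R)).
Local Notation C := R[i].

(** The terms of the edge and of its reverse agree, because the phase has
    modulus 1. *)
Lemma energy_del (G : mgraph A) (e0 : edge G) (phi : vert G -> C) :
  energy phi = `|phi (src e0) - expi (alpha e0) * phi (tgt e0)| ^+ 2
    + @energy R A (del_mgraph e0) phi.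
Proof.
rewrite /energy (sum_del e0) mulrDr; congr (_ + _).
have -> : `|phi (src (bar e0)) - expi (alpha (bar e0)) * phi (tgt (bar e0))| =
          `|phi (src e0) - expi (alpha e0) * phi (tgt e0)|.
  rewrite /src /tgt bd_bar alpha_bar expiN /=.
  set y := phi _; set x := phi _; set z := expi _.
  have zz : z^* * z = 1 by rewrite mulrC -normCK normr_expi expr1n.
  have -> : y - z^* * x = - z^* * (x - z * y).
    by rewrite mulrBr !mulNr mulrA zz mul1r; ring.
  by rewrite normrM normrN norm_conjC normr_expi mul1r.
by rewrite -mulr2n -[(_ ^+ 2) *+ 2]mulr_natl mulKf // pnatr_eq0.
Qed.

Section Spectra.
Variables (G : mgraph A) (e0 : edge G) (w w' : vert G -> R) (s s' : nat -> R).
Hypothesis Gs : diagonalized (wsqnorm w) (@energy R A G) s.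
Hypothesis Gs' : diagonalized (wsqnorm w') (@energy R A (del_mgraph e0)) s'.

(** On the hyperplane where the deleted edge carries no energy, both energies
    agree. *)
Lemma le_shift_del k : (forall v, w' v <= w v) ->
  (k + 1 < #|vert G|)%N -> s k <= s' (k + 1)%N.
Proof.
move=> w'w kV; pose h (_ : 'I_1) (v : vert G) : C :=
  (src e0 == v)%:R - expi (alpha e0) * (tgt e0 == v)%:R.
apply: (minmax_shift (h := h) Gs Gs' kV) => phi /(_ ord0); rewrite sum_hyperplane => h0.
rewrite (energy_del e0) h0 normr0 expr0n add0r => /le_trans; apply.
by rewrite ler_wpM2l ?le_wsqnorm // lecR (@diagonalized_ge0 _ _ (del_mgraph e0) _ _ _ Gs').
Qed.

(** Deletion lowers the energy and does not lower the norm. *)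
Lemma del_le k : (forall v, w v <= w' v) ->
  (k < #|vert G|)%N -> s' k <= s k.
Proof.
move=> ww' kV; pose h (_ : 'I_0) (v : vert G) : C := 0.
rewrite -[X in _ <= s X]addn0.
apply: (minmax_shift (h := h) Gs' Gs); rewrite addn0 // => phi _ le_q.
apply: (@le_trans _ _ (energy phi)); last apply: le_trans le_q _.
  by rewrite (energy_del e0) lerDr exprn_ge0.
by rewrite ler_wpM2l ?le_wsqnorm // lecR (diagonalized_ge0 Gs).
Qed.

(** The constraint phi(u) = - z phi(v) is chosen to maximize the energy of the
    deleted edge, which becomes 4 |phi(u)|^2; the loss of norm costs at most
    l * 2 |phi(u)|^2, and l <= 2 for the eigenvalue l of the larger graph. For a
    loop the constraint may be void, and the same computation applies. *)
Lemma del_le_shift k :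
  (forall v, w v <= w' v + ((src e0 == v) + (tgt e0 == v))%:R) ->
  (forall v : vert G, (deg v)%:R <= w v) ->
  (k + 1 < #|vert G|)%N -> s' k <= s (k + 1)%N.
Proof.
move=> ww' deg_w kV; pose h (_ : 'I_1) (v : vert G) : C :=
  (src e0 == v)%:R - - expi (alpha e0) * (tgt e0 == v)%:R.
apply: (minmax_shift (h := h) Gs' Gs kV) => phi /(_ ord0).
rewrite sum_hyperplane => /subr0_eq; rewrite mulNr (energy_del e0) => h0.
set l := s _; set x := phi (src e0) in h0 *; set y := phi (tgt e0) in h0 *.
have xy : `|x| = `|y| by rewrite h0 normrN normrM normr_expi mul1r.
have -> : x - expi (alpha e0) * y = 2 * x by rewrite h0; ring.
have l0 : 0 <= l%:C by rewrite lecR (diagonalized_ge0 Gs).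
have l2 : l%:C <= 2 by rewrite -(rmorph_nat (real_complex R)) lecR (diagonalized_le2 deg_w Gs).
have Nw : wsqnorm w phi <= wsqnorm w' phi + 2 * `|x| ^+ 2.
  have -> : 2 * `|x| ^+ 2 = \sum_v ((src e0 == v) + (tgt e0 == v))%:R * `|phi v| ^+ 2.
    under eq_bigr do rewrite natrD mulrDl.
    by rewrite big_split /= !sum_delta -/x -/y -xy mulr_natl.
  rewrite -big_split; apply: ler_sum => v _ /=; rewrite -mulrDl.
  rewrite ler_wpM2r ?exprn_ge0 // -(rmorph_nat (real_complex R)) -rmorphD.
  by rewrite lecR.
move=> le_q; have := le_trans le_q (ler_wpM2l l0 Nw).
rewrite normrM exprMn normr_nat mulrDr => le_q'.
rewrite -(lerD2l (2 ^+ 2 * `|x| ^+ 2)) (le_trans le_q') // addrC lerD2r.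
rewrite mulrA ler_wpM2r ?exprn_ge0 //.
by rewrite expr2 ler_wpM2r.
Qed.

End Spectra.

Lemma del_mw_le (G G' : mwgraph A) (e0 : edge G) :
  mgraph_of G' = del_mgraph e0 -> combinatorial G -> combinatorial G' -> mw_le G' G.
Proof.
case: G' => m w ew wP ewP ewb /= E; subst m => -[vw1 ew1] [/= vw1' ew1'].
exists id, val; split=> //= [v|e].
  by rewrite (big_pred1 v) // vw1 vw1'.
rewrite ew1; have [ke|nke] := boolP (kept e0 e).
  by rewrite (big_pred1 (exist _ e ke)) ?ew1'.
rewrite big_pred0 // => -[e' ke'] /=; apply: contraNF nke => /eqP <-.
exact: ke'.
Qed.

End Deletion.

Theorem corollary4p2 (R : realType) (A : zmodClosed (angle R))
    (G G' : mwgraph A) (e0 : edge G)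
    (hdel : mgraph_of G' = del_mgraph e0) :
  (combinatorial G -> combinatorial G' ->
     [/\ spectral_le 1 G G', mw_le G' G,
         (spectral_le 1 G G' /\ spectral_le 0 G' G)
       & ~ is_loop e0 ->
         exists k : nat,
           (1 <= k <= nvert G)%N /\ lambda G' k < lambda G k]) /\
  (standard G -> standard G' ->
     spectral_le 1 G G' /\ spectral_le 1 G' G).
Proof.
have mw := @del_mw_le R A G G' e0 hdel.
case: G' hdel mw => m vw' ew' vwP ewP ewb /= hdel; subst m => mw.
set G' := MWGraph _ _ _ in mw *.
have nV : nvert G' = nvert G by [].
split=> [cG cG'|[vG eG] [vG' eG']].
  have [vG eG] := cG; have [vG' eG'] := cG'.
  have dG : diagonalized (wsqnorm (fun=> 1)) (@energy R A G) (nth 0 (spectrum G)).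
    by apply: laplacian_diagonalized => // v; right.
  have dG' : diagonalized (wsqnorm (fun=> 1)) (@energy R A (del_mgraph e0))
      (nth 0 (spectrum G')).
    by apply: (@laplacian_diagonalized _ _ G') => // v; right.
  have le1 : spectral_le 1 G G'.
    split=> [|[|k] // /andP[_ kn]]; first by rewrite nV leq_subr.
    by apply: (le_shift_del dG dG') => //; move: kn; rewrite nV /nvert; lia.
  have le0 : spectral_le 0 G' G.
    split=> [|[|k] // /andP[_ kn]]; first by rewrite nV leq_subr.
    by rewrite addn0; apply: (del_le dG dG') => //; move: kn; rewrite /nvert; lia.
  split=> //; first exact: mw.
  move=> nloop.
  have [/existsP[k lt_k]|/existsPn no] :=
      boolP [exists k : 'I_(nvert G), lambda G' k.+1 < lambda G k.+1].
    by exists k.+1; rewrite ltn_ord.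
  (* otherwise the traces compare the wrong way round: deletion lowers the
     trace by 1 at each end of the edge *)
  have : \tr (laplacian_mx G) <= \tr (laplacian_mx G').
    by rewrite -!sum_spectrum lecR; apply: ler_sum => i _; rewrite leNgt no.
  have st : (src e0 == tgt e0) = false by apply/eqP.
  rewrite !tr_laplacian // (sum_del e0) gerDr /src /tgt bd_bar /=.
  rewrite -/(src e0) -/(tgt e0) eq_sym st !mulr0 !subr0.
  by rewrite -(natrD _ 1 1) lern0.
(* the standard weight, made positive at isolated vertices *)
pose w (H : graph) (v : vert H) : R := (maxn 1 (deg v))%:R.
have wP (H : mwgraph A) : standard H ->
  diagonalized (wsqnorm (@w H)) (@energy R A H) (nth 0 (spectrum H)).
  move=> [vH eH]; apply: laplacian_diagonalized => // v.
    by rewrite ltr0n leq_maxl.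
  rewrite vH /w; case: (deg v) => [|d]; [by left|right].
  by rewrite (maxn_idPr _).
have dG := wP G (conj vG eG); have dG' := wP G' (conj vG' eG').
have dE v := deg_del e0 v.
have max_mono d d' : (maxn 1 d' <= maxn 1 (d + d'))%N by lia.
have max_add d d' : (maxn 1 (d + d') <= maxn 1 d' + d)%N by lia.
split; (split=> [|[|k] // /andP[_ kn]]; first by rewrite nV leq_subr).
  apply: (le_shift_del dG dG'); last by move: kn; rewrite nV /nvert; lia.
  by move=> v; rewrite /w ler_nat dE.
apply: (del_le_shift dG dG'); last by move: kn; rewrite /nvert; lia.
  by move=> v; rewrite /w -natrD ler_nat dE.
by move=> v; rewrite ler_nat leq_maxr.
Qed.
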